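(* In a braided Ann-category, the commutativity of the diagrams (2) and (3) displayed in the context can be deduced from the other axioms. That is: let $(\mathcal{A},\oplus,\otimes)$ be a category with two bifunctors, equipped with objects $0,1$ and natural isomorphisms $a^+,c^+,g,d,a,l,r,c,\mathfrak{L},\mathfrak{R}$ of the types listed in the context, satisfying all the axioms of a braided Ann-category except possibly (2) and (3). Then (2) and (3) hold for all objects.
   Context: Write $AB$ for $A\otimes B$. An Ann-category consists of a category $\mathcal{A}$ with bifunctors $\oplus,\otimes:\mathcal{A}\times\mathcal{A}\to\mathcal{A}$ and: (i) an object $0$ and natural isomorphisms $a^+_{X,Y,Z}:X\oplus(Y\oplus Z)\to(X\oplus Y)\oplus Z$, $c^+_{X,Y}:X\oplus Y\to Y\oplus X$, $g_X:0\oplus X\to X$, $d_X:X\oplus0\to X$ making $(\mathcal{A},\oplus)$ a symmetric categorical group, i.e. a symmetric monoidal category that is a groupoid and in which every object $X$ has an object $X'$ with $X\oplus X'\cong 0$; (ii) an object $1$ and natural isomorphisms $a_{A,B,C}:A(BC)\to(AB)C$, $l_X:1X\to X$, $r_X:X1\to X$ making $(\mathcal{A},\otimes)$ a monoidal category; (iii) natural isomorphisms $\mathfrak{L}_{A,X,Y}:A(X\oplus Y)\to AX\oplus AY$ and $\mathfrak{R}_{X,Y,A}:(X\oplus Y)A\to XA\oplus YA$, such that the following hold for all objects. (Ann-1) The functors $A\otimes-$ (with $\mathfrak{L}_{A,-,-}$) and $-\otimes A$ (with $\mathfrak{R}_{-,-,A}$) are compatible with $a^+$ and $c^+$: $(\mathfrak{L}_{A,X,Y}\oplus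 \mathrm{id})\mathfrak{L}_{A,X\oplus Y,Z}(\mathrm{id}_A\otimes a^+_{X,Y,Z})=a^+_{AX,AY,AZ}(\mathrm{id}\oplus\mathfrak{L}_{A,Y,Z})\mathfrak{L}_{A,X,Y\oplus Z}$ and $c^+_{AX,AY}\mathfrak{L}_{A,X,Y}=\mathfrak{L}_{A,Y,X}(\mathrm{id}_A\otimes c^+_{X,Y})$, and likewise $(\mathfrak{R}_{X,Y,A}\oplus \mathrm{id})\mathfrak{R}_{X\oplus Y,Z,A}(a^+_{X,Y,Z}\otimes \mathrm{id}_A)=a^+_{XA,YA,ZA}(\mathrm{id}\oplus\mathfrak{R}_{Y,Z,A})\mathfrak{R}_{X,Y\oplus Z,A}$ and $c^+_{XA,YA}\mathfrak{R}_{X,Y,A}=\mathfrak{R}_{Y,X,A}(c^+_{X,Y}\otimes \mathrm{id}_A)$. (Ann-2) (1) $\mathfrak{L}_{AB,X,Y}\circ a_{A,B,X\oplus Y}=(a_{A,B,X}\oplus a_{A,B,Y})\circ\mathfrak{L}_{A,BX,BY}\circ(\mathrm{id}_A\otimes\mathfrak{L}_{B,X,Y})$; (2) $(a_{X,B,A}\oplus a_{Y,B,A})\circ\mathfrak{R}_{X,Y,BA}=\mathfrak{R}_{XB,YB,A}\circ(\mathfrak{R}_{X,Y,B}\otimes \mathrm{id}_A)\circ a_{X\oplus Y,B,A}$; (3) $\mathfrak{R}_{AX,AY,B}\circ(\mathfrak{L}_{A,X,Y}\otimes \mathrm{id}_B)\circ a_{A,X\oplus Y,B}=(a_{A,X,B}\oplus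 a_{A,Y,B})\circ\mathfrak{L}_{A,XB,YB}\circ(\mathrm{id}_A\otimes\mathfrak{R}_{X,Y,B})$; (4) $v\circ(\mathfrak{R}_{A,B,X}\oplus\mathfrak{R}_{A,B,Y})\circ\mathfrak{L}_{A\oplus B,X,Y}=(\mathfrak{L}_{A,X,Y}\oplus\mathfrak{L}_{B,X,Y})\circ\mathfrak{R}_{A,B,X\oplus Y}$, where $v=v_{U,V,Z,T}:(U\oplus V)\oplus(Z\oplus T)\to(U\oplus Z)\oplus(V\oplus T)$ is the canonical isomorphism built from $a^+,c^+,\mathrm{id}$ (interchanging $V$ and $Z$). (Ann-3) (5.1) $(l_X\oplus l_Y)\circ\mathfrak{L}_{1,X,Y}=l_{X\oplus Y}$; (5.2) $(r_X\oplus r_Y)\circ\mathfrak{R}_{X,Y,1}=r_{X\oplus Y}$. A braided Ann-category is an Ann-category with a natural isomorphism $c_{A,B}:AB\to BA$ such that $(\mathcal{A},\otimes,a,c,(1,l,r))$ is a braided tensor (monoidal) category, with $c_{0,0}=\mathrm{id}$ and (6) $\mathfrak{R}_{X,Y,A}\circ c_{A,X\oplus Y}=(c_{A,X}\oplus c_{A,Y})\circ\mathfrak{L}_{A,X,Y}$. *)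

(* Defs.v *)
Set Implicit Arguments.
Unset Strict Implicit.
Unset Printing Implicit Defensive.

Declare Scope cat_scope.
Delimit Scope cat_scope with cat.
Open Scope cat_scope.

Record Category : Type := {
  Ob :> Type;
  Hom : Ob -> Ob -> Type;
  idm : forall X, Hom X X;
  comp : forall X Y Z, Hom Y Z -> Hom X Y -> Hom X Z;
  comp_assoc : forall X Y Z T (h : Hom Z T) (g : Hom Y Z) (f : Hom X Y),
      comp h (comp g f) = comp (comp h g) f;
  comp_id_l : forall X Y (f : Hom X Y), comp (idm Y) f = f;
  comp_id_r : forall X Y (f : Hom X Y), comp f (idm X) = f }.

Arguments Hom {_} _ _.
Arguments idm {_} _.
Arguments comp {_ _ _ _} _ _.
Notation "g ∘ f" := (comp g f) (at level 40, left associativity) : cat_scope.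

Record Iso (C : Category) (X Y : C) : Type := {
  iso_hom :> Hom X Y;
  iso_inv : Hom Y X;
  iso_inv_hom : iso_inv ∘ iso_hom = idm X;
  iso_hom_inv : iso_hom ∘ iso_inv = idm Y }.

Notation "f '⁻¹'" := (iso_inv f) (at level 2, left associativity, format "f '⁻¹'") : cat_scope.

Definition is_iso (C : Category) (X Y : C) (f : Hom X Y) : Prop :=
  exists g : Hom Y X, g ∘ f = idm X /\ f ∘ g = idm Y.

Record Bifunctor (C : Category) : Type := {
  bi_ob : C -> C -> C;
  bi_map : forall X X' Y Y', Hom X X' -> Hom Y Y' -> Hom (bi_ob X Y) (bi_ob X' Y');
  bi_map_id : forall X Y, bi_map (idm X) (idm Y) = idm (bi_ob X Y);
  bi_map_comp : forall X X' X'' Y Y' Y''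
      (f' : Hom X' X'') (f : Hom X X') (g' : Hom Y' Y'') (g : Hom Y Y'),
      bi_map (f' ∘ f) (g' ∘ g) = bi_map f' g' ∘ bi_map f g }.

Arguments bi_map {_} _ {_ _ _ _} _ _.

(* The associator goes from X(YZ) to (XY)Z. *)
Record Monoidal (C : Category) : Type := {
  mon_bi :> Bifunctor C;
  mon_unit : C;
  mon_assoc : forall X Y Z : C,
      Iso (bi_ob mon_bi X (bi_ob mon_bi Y Z)) (bi_ob mon_bi (bi_ob mon_bi X Y) Z);
  mon_lunit : forall X : C, Iso (bi_ob mon_bi mon_unit X) X;
  mon_runit : forall X : C, Iso (bi_ob mon_bi X mon_unit) X;
  mon_assoc_natural : forall (X X' Y Y' Z Z' : C)
      (f : Hom X X') (g : Hom Y Y') (h : Hom Z Z'),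
      mon_assoc X' Y' Z' ∘ bi_map mon_bi f (bi_map mon_bi g h)
      = bi_map mon_bi (bi_map mon_bi f g) h ∘ mon_assoc X Y Z;
  mon_lunit_natural : forall (X X' : C) (f : Hom X X'),
      mon_lunit X' ∘ bi_map mon_bi (idm mon_unit) f = f ∘ mon_lunit X;
  mon_runit_natural : forall (X X' : C) (f : Hom X X'),
      mon_runit X' ∘ bi_map mon_bi f (idm mon_unit) = f ∘ mon_runit X;
  mon_pentagon : forall X Y Z T : C,
      mon_assoc (bi_ob mon_bi X Y) Z T ∘ mon_assoc X Y (bi_ob mon_bi Z T)
      = bi_map mon_bi (mon_assoc X Y Z) (idm T)
        ∘ mon_assoc X (bi_ob mon_bi Y Z) T
        ∘ bi_map mon_bi (idm X) (mon_assoc Y Z T);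
  mon_triangle : forall X Y : C,
      bi_map mon_bi (mon_runit X) (idm Y) ∘ mon_assoc X mon_unit Y
      = bi_map mon_bi (idm X) (mon_lunit Y) }.

Arguments mon_unit {_} _.
Arguments mon_assoc {_} _ _ _ _.
Arguments mon_lunit {_} _ _.
Arguments mon_runit {_} _ _.

(* Joyal-Street braiding; compatibility with the unit constraints is a
   consequence of the two hexagons and is not required separately. *)
Record Braiding (C : Category) (M : Monoidal C) : Type := {
  braid :> forall X Y : C, Iso (bi_ob M X Y) (bi_ob M Y X);
  braid_natural : forall (X X' Y Y' : C) (f : Hom X X') (g : Hom Y Y'),
      braid X' Y' ∘ bi_map M f g = bi_map M g f ∘ braid X Y;
  braid_hexagon_r : forall X Y Z : C,
      iso_hom (braid X (bi_ob M Y Z))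
      = mon_assoc M Y Z X ∘ bi_map M (idm Y) (braid X Z) ∘ (mon_assoc M Y X Z)⁻¹
        ∘ bi_map M (braid X Y) (idm Z) ∘ mon_assoc M X Y Z;
  braid_hexagon_l : forall X Y Z : C,
      iso_hom (braid (bi_ob M X Y) Z)
      = (mon_assoc M Z X Y)⁻¹ ∘ bi_map M (braid X Z) (idm Y) ∘ mon_assoc M X Z Y
        ∘ bi_map M (idm X) (braid Y Z) ∘ (mon_assoc M X Y Z)⁻¹ }.

Definition is_symmetric (C : Category) (M : Monoidal C) (c : Braiding M) : Prop :=
  forall X Y : C, c Y X ∘ c X Y = idm (bi_ob M X Y).

Definition is_categorical_group (C : Category) (M : Monoidal C) : Prop :=
  (forall (X Y : C) (f : Hom X Y), is_iso f) /\
  (forall X : C, exists X' : C, inhabited (Iso (bi_ob M X X') (mon_unit M))).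

Record Distributivity (C : Category) (P T : Monoidal C) : Type := {
  dist_l : forall A X Y : C,
      Iso (bi_ob T A (bi_ob P X Y)) (bi_ob P (bi_ob T A X) (bi_ob T A Y));
  dist_r : forall X Y A : C,
      Iso (bi_ob T (bi_ob P X Y) A) (bi_ob P (bi_ob T X A) (bi_ob T Y A));
  dist_l_natural : forall (A A' X X' Y Y' : C)
      (f : Hom A A') (g : Hom X X') (h : Hom Y Y'),
      dist_l A' X' Y' ∘ bi_map T f (bi_map P g h)
      = bi_map P (bi_map T f g) (bi_map T f h) ∘ dist_l A X Y;
  dist_r_natural : forall (X X' Y Y' A A' : C)
      (g : Hom X X') (h : Hom Y Y') (f : Hom A A'),
      dist_r X' Y' A' ∘ bi_map T (bi_map P g h) f
      = bi_map P (bi_map T g f) (bi_map T h f) ∘ dist_r X Y A }.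

Section Coherence.

Context (C : Category) (P T : Monoidal C).
Context (cp : Braiding P) (c : Braiding T) (D : Distributivity P T).

Local Notation "X ⊕ Y" := (bi_ob P X Y) (at level 50, left associativity).
Local Notation "X ⊗ Y" := (bi_ob T X Y) (at level 36, left associativity).
Local Notation "f [+] g" := (bi_map P f g) (at level 38, left associativity).
Local Notation "f [x] g" := (bi_map T f g) (at level 36, left associativity).
Local Notation "𝟎" := (mon_unit P).
Local Notation "𝟏" := (mon_unit T).
Local Notation ap := (mon_assoc P).
Local Notation a := (mon_assoc T).
Local Notation l := (mon_lunit T).
Local Notation r := (mon_runit T).
Local Notation L := (dist_l D).
Local Notation R := (dist_r D).

Definition interchange (U V Z W : C) : Hom ((U ⊕ V) ⊕ (Z ⊕ W)) ((U ⊕ Z) ⊕ (V ⊕ W)) :=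
  ap U Z (V ⊕ W)
  ∘ (idm U [+] (ap Z V W)⁻¹)
  ∘ (idm U [+] (cp V Z [+] idm W))
  ∘ (idm U [+] ap V Z W)
  ∘ (ap U V (Z ⊕ W))⁻¹.

Record ann_1 : Prop := {
  ann_1_L_assoc : forall A X Y Z : C,
      (L A X Y [+] idm (A ⊗ Z)) ∘ L A (X ⊕ Y) Z ∘ (idm A [x] ap X Y Z)
      = ap (A ⊗ X) (A ⊗ Y) (A ⊗ Z) ∘ (idm (A ⊗ X) [+] L A Y Z) ∘ L A X (Y ⊕ Z);
  ann_1_L_comm : forall A X Y : C,
      cp (A ⊗ X) (A ⊗ Y) ∘ L A X Y = L A Y X ∘ (idm A [x] cp X Y);
  ann_1_R_assoc : forall A X Y Z : C,
      (R X Y A [+] idm (Z ⊗ A)) ∘ R (X ⊕ Y) Z A ∘ (ap X Y Z [x] idm A)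
      = ap (X ⊗ A) (Y ⊗ A) (Z ⊗ A) ∘ (idm (X ⊗ A) [+] R Y Z A) ∘ R X (Y ⊕ Z) A;
  ann_1_R_comm : forall A X Y : C,
      cp (X ⊗ A) (Y ⊗ A) ∘ R X Y A = R Y X A ∘ (cp X Y [x] idm A) }.

Definition ann_2_1 : Prop := forall A B X Y : C,
  L (A ⊗ B) X Y ∘ a A B (X ⊕ Y)
  = (a A B X [+] a A B Y) ∘ L A (B ⊗ X) (B ⊗ Y) ∘ (idm A [x] L B X Y).

Definition ann_2_2 : Prop := forall A B X Y : C,
  (a X B A [+] a Y B A) ∘ R X Y (B ⊗ A)
  = R (X ⊗ B) (Y ⊗ B) A ∘ (R X Y B [x] idm A) ∘ a (X ⊕ Y) B A.

Definition ann_2_3 : Prop := forall A B X Y : C,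
  R (A ⊗ X) (A ⊗ Y) B ∘ (L A X Y [x] idm B) ∘ a A (X ⊕ Y) B
  = (a A X B [+] a A Y B) ∘ L A (X ⊗ B) (Y ⊗ B) ∘ (idm A [x] R X Y B).

Definition ann_2_4 : Prop := forall A B X Y : C,
  interchange (A ⊗ X) (B ⊗ X) (A ⊗ Y) (B ⊗ Y)
    ∘ (R A B X [+] R A B Y) ∘ L (A ⊕ B) X Y
  = (L A X Y [+] L B X Y) ∘ R A B (X ⊕ Y).

Record ann_3 : Prop := {
  ann_3_l : forall X Y : C, (l X [+] l Y) ∘ L 𝟏 X Y = l (X ⊕ Y);
  ann_3_r : forall X Y : C, (r X [+] r Y) ∘ R X Y 𝟏 = r (X ⊕ Y) }.

Definition braid_zero : Prop := iso_hom (c 𝟎 𝟎) = idm (𝟎 ⊗ 𝟎).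

Definition braid_dist : Prop := forall A X Y : C,
  R X Y A ∘ c A (X ⊕ Y) = (c A X [+] c A Y) ∘ L A X Y.

End Coherence.

(* Main.v *)
Require Import Defs.

(** Write [A B] for the tensor product.  By (6), the braiding turns [L] into
    [R], and a hexagon splits a braiding past a tensor product.  Precomposing
    (3) with [c B (A (X ⊕ Y))] and using the hexagon for [c X (Y Z)], both sides
    agree by (1), which enters twice: for [(B, A)] and for [(A, B)].
    Precomposing (2) with [c (B A) (X ⊕ Y)] and using the hexagon for
    [c (X Y) Z], one is left with (1) and (3). *)

Section Cancellation.

Context (C : Category).

Lemma iso_cancel_r (X Y Z : C) (i : Iso X Y) (f g : Hom Y Z) :
  f ∘ i = g ∘ i -> f = g.
Proof.
  intros H.
  rewrite <- (comp_id_r f), <- (comp_id_r g), <- (iso_hom_inv i), !comp_assoc, H.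
  reflexivity.
Qed.

Lemma iso_move_r (X Y Z : C) (i : Iso X Y) (f : Hom Y Z) (g : Hom X Z) :
  f = g ∘ i⁻¹ -> f ∘ i = g.
Proof.
  intros ->. rewrite <- comp_assoc, iso_inv_hom. apply comp_id_r.
Qed.

Lemma iso_move_inv_r (X Y Z : C) (i : Iso X Y) (f : Hom X Z) (g : Hom Y Z) :
  f = g ∘ i -> f ∘ i⁻¹ = g.
Proof.
  intros ->. rewrite <- comp_assoc, iso_hom_inv. apply comp_id_r.
Qed.

Lemma iso_move_l (X Y Z : C) (i : Iso Y Z) (f : Hom X Y) (g : Hom X Z) :
  f = i⁻¹ ∘ g -> i ∘ f = g.
Proof.
  intros ->. rewrite comp_assoc, iso_hom_inv. apply comp_id_l.
Qed.

Lemma bi_map_comp_idl (F : Bifunctor C) (A X Y Z : C) (g : Hom Y Z) (f : Hom X Y) :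
  bi_map F (idm A) (g ∘ f) = bi_map F (idm A) g ∘ bi_map F (idm A) f.
Proof.
  rewrite <- bi_map_comp, comp_id_l. reflexivity.
Qed.

Lemma bi_map_comp_idr (F : Bifunctor C) (A X Y Z : C) (g : Hom Y Z) (f : Hom X Y) :
  bi_map F (g ∘ f) (idm A) = bi_map F g (idm A) ∘ bi_map F f (idm A).
Proof.
  rewrite <- bi_map_comp, comp_id_l. reflexivity.
Qed.

Lemma bi_map_inv_l (F : Bifunctor C) (X X' Y Y' : C) (i : Iso X X') (j : Iso Y Y') :
  bi_map F i⁻¹ j⁻¹ ∘ bi_map F i j = idm (bi_ob F X Y).
Proof.
  rewrite <- bi_map_comp, !iso_inv_hom. apply bi_map_id.
Qed.

End Cancellation.

Section BraidedDistributivity.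

Context (C : Category) (P T : Monoidal C) (c : Braiding T) (D : Distributivity P T).
Context (H21 : ann_2_1 D) (H6 : braid_dist c D).

Local Notation "X ⊕ Y" := (bi_ob P X Y) (at level 50, left associativity).
Local Notation "X ⊗ Y" := (bi_ob T X Y) (at level 36, left associativity).
Local Notation "f [+] g" := (bi_map P f g) (at level 38, left associativity).
Local Notation "f [x] g" := (bi_map T f g) (at level 36, left associativity).
Local Notation a := (mon_assoc T).
Local Notation L := (dist_l D).
Local Notation R := (dist_r D).

(** Axiom (1) solved for the inverse associators, since the hexagons leave [a⁻¹] standing to the
    left of [L]. *)
Lemma dist_l_tensor_inv (A B X Y : C) :
  ((a A B X)⁻¹ [+] (a A B Y)⁻¹) ∘ L (A ⊗ B) X Y
  = L A (B ⊗ X) (B ⊗ Y) ∘ (idm A [x] L B X Y) ∘ (a A B (X ⊕ Y))⁻¹.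
Proof.
  symmetry. apply iso_move_inv_r.
  rewrite <- (comp_assoc _ _ (a _ _ _)), H21, !comp_assoc.
  rewrite bi_map_inv_l, comp_id_l. reflexivity.
Qed.

(** Naturality of [L] in its two summands moves the braidings under [idm A [x] _], where (6) trades
    [L] for [R]. *)
Lemma dist_l_braid (A B X Y : C) :
  (idm A [x] c B X [+] idm A [x] c B Y) ∘ L A (B ⊗ X) (B ⊗ Y) ∘ (idm A [x] L B X Y)
  = L A (X ⊗ B) (Y ⊗ B) ∘ (idm A [x] R X Y B) ∘ (idm A [x] c B (X ⊕ Y)).
Proof.
  rewrite <- dist_l_natural, <- !comp_assoc, <- !bi_map_comp_idl, H6. reflexivity.
Qed.

Lemma ann_2_3_of_braid_dist : ann_2_3 D.
Proof.
  intros A B X Y.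
  (* The associator goes to the right-hand side first: there its inverse cancels the leading factor
     of the hexagon for the braiding. *)
  apply iso_move_r, (iso_cancel_r _ _ _ _ (c B (A ⊗ (X ⊕ Y)))).
  rewrite <- (comp_assoc (R _ _ _)), <- braid_natural, comp_assoc, H6.
  rewrite !braid_hexagon_r, !bi_map_comp, <- !comp_assoc.
  pose proof (H21 B A X Y) as H; rewrite <- comp_assoc in H.
  rewrite <- H; clear H.
  (* Naturality of [L] in its first argument carries [c B A] across and replaces [L (B ⊗ A)] by
     [L (A ⊗ B)], so that (1) applies again with [A] and [B] swapped. *)
  rewrite (comp_assoc _ (L (B ⊗ A) X Y)), <- dist_l_natural, bi_map_id.
  rewrite <- (comp_assoc (L (A ⊗ B) X Y)), (comp_assoc _ (L (A ⊗ B) X Y)).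
  rewrite dist_l_tensor_inv.
  rewrite (comp_assoc (a A (X ⊕ Y) B)⁻¹), iso_inv_hom, comp_id_l.
  rewrite (comp_assoc _ (L _ _ _ ∘ _ ∘ _)), (comp_assoc _ (L _ _ _ ∘ _)).
  rewrite (comp_assoc _ (L _ _ _)), dist_l_braid, <- !comp_assoc.
  reflexivity.
Qed.

(** The hexagon rearranged for the composite that arises on both sides of (2) after precomposing
    with the braiding. *)
Lemma assoc_braid_tensor (X Y Z : C) :
  a Z X Y ∘ c (X ⊗ Y) Z
  = (c X Z [x] idm Y) ∘ a X Z Y ∘ (idm X [x] c Y Z) ∘ (a X Y Z)⁻¹.
Proof.
  apply iso_move_l. rewrite braid_hexagon_l, !comp_assoc. reflexivity.
Qed.

Lemma ann_2_2_of_braid_dist : ann_2_2 D.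
Proof.
  intros A B X Y.
  apply (iso_cancel_r _ _ _ _ (c (B ⊗ A) (X ⊕ Y))).
  rewrite <- comp_assoc, H6, comp_assoc, <- bi_map_comp.
  rewrite <- (comp_assoc _ (a _ _ _)), !assoc_braid_tensor, !bi_map_comp.
  rewrite <- (comp_assoc _ _ (L _ _ _)), dist_l_tensor_inv.
  rewrite (comp_assoc _ (L _ _ _ ∘ _)), <- (comp_assoc _ _ (L _ _ _ ∘ _)).
  rewrite (comp_assoc _ (L _ _ _)), dist_l_braid.
  rewrite !comp_assoc.
  (* On the right-hand side, (6) under [_ [x] idm A] and naturality of [R] pull the braidings with
     [B] out to the left; what follows them begins with the left side of (3), with [B], [A] for its
     [A], [B]. *)
  rewrite <- (comp_assoc (R _ _ _)), <- bi_map_comp_idr, H6, bi_map_comp_idr.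
  rewrite comp_assoc, dist_r_natural.
  rewrite <- (comp_assoc _ (R _ _ _)), <- (comp_assoc _ _ (a _ _ _)).
  rewrite ann_2_3_of_braid_dist, !comp_assoc.
  reflexivity.
Qed.

End BraidedDistributivity.

Theorem proposition3p3 (C : Category) (P T : Monoidal C)
  (cp : Braiding P) (c : Braiding T) (D : Distributivity P T)
  (Hsym : is_symmetric cp) (Hgrp : is_categorical_group P)
  (H1 : ann_1 cp D) (H21 : ann_2_1 D) (H24 : ann_2_4 cp D) (H3 : ann_3 D)
  (Hc00 : braid_zero P c) (H6 : braid_dist c D) :
  ann_2_2 D /\ ann_2_3 D.
Proof.
  split.
  - exact (ann_2_2_of_braid_dist _ _ _ c D H21 H6).
  - exact (ann_2_3_of_braid_dist _ _ _ c D H21 H6).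
Qed.
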